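(* Let $w$ be an infinite word over a finite totally ordered alphabet $A\supseteq\{0,1\}$ with $0<1$, such that both letters $0$ and $1$ occur in $w$. Then $w$ is Sturmian if and only if for every pair $v,v'$ of lexicographically consecutive factors of $w$ of the same length, there exist words $\lambda,\mu\in A^*$ such that $v,v'$ either both belong to $\{\lambda 01\mu,\ \lambda 10\mu\}$ or both belong to $\{\lambda 0,\ \lambda 1\}$.
   Context: $A^*$ is the set of finite words over $A$ (including the empty word). An infinite word over $A$ is a sequence in $A^\omega$ (indexed by $\mathbb{N}$). A factor of $w$ is a finite word occurring as a block of consecutive letters of $w$; $\mathrm{Fact}(w)$ is the set of factors of $w$. For finite words, $v<_{\mathrm{lex}}v'$ means $|v|=|v'|$ and there are a word $\lambda$ and letters $a<b$ such that $\lambda a$ is a prefix of $v$ and $\lambda b$ is a prefix of $v'$. Two factors $v,v'$ of $w$ are lexicographically consecutive (with $v'$ the successor of $v$, written $v'=\mathrm{succ}_w(v)$) if $v<_{\mathrm{lex}}v'$ and there is no $f\in\mathrm{Fact}(w)$ with $v<_{\mathrm{lex}}f<_{\mathrm{lex}}v'$. An infinite word $w$ is Sturmian if for every $n\ge 0$ it has exactly $n+1$ distinct factors of length $n$ (equivalently, $w$ is a binary word that is not ultimately periodic and is balanced, i.e. for any two factors $u,u'$ of equal length and each letter $x$, the numbers of occurrences of $x$ in $u$ and in $u'$ differ by at most $1$). *)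

(* Defs.v *)
From mathcomp Require Import all_boot all_order.
From mathcomp Require Import boolp.

Set Implicit Arguments.
Unset Strict Implicit.
Unset Printing Implicit Defensive.

Import Order.TTheory.

(* Infinite words over A are functions nat -> A, finite words are seq A. *)

Definition factor (A : Type) (w : nat -> A) (u : seq A) : Prop :=
  exists i : nat, u = [seq w (i + k)%N | k <- iota 0 (size u)].

Definition lex_lt (d : Order.disp_t) (A : finOrderType d) (v v' : seq A) : Prop :=
  size v = size v' /\
  exists (l : seq A) (a b : A),
    [/\ (a < b)%O, prefix (rcons l a) v & prefix (rcons l b) v'].

(* v' is the successor of v in w; the two words have the same length by lex_lt. *)
Definition lex_consecutive (d : Order.disp_t) (A : finOrderType d)
    (w : nat -> A) (v v' : seq A) : Prop :=
  [/\ factor w v, factor w v', lex_lt v v' &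
      ~ exists f : seq A, [/\ factor w f, lex_lt v f & lex_lt f v']].

Definition sturmian (A : finType) (w : nat -> A) : Prop :=
  forall n : nat, #|[set u : n.-tuple A | `[< factor w u >]]| = n.+1.

(* Main.v *)
Require Import Defs.
From mathcomp Require Import all_boot all_order.
From mathcomp Require Import boolp zify.

Set Implicit Arguments.
Unset Strict Implicit.
Unset Printing Implicit Defensive.

(* Call a word x right special when x0 and x1 are both factors. In the factor tree
   of a binary word, w is Sturmian iff there is exactly one right special word of each
   length, and a lexicographically consecutive pair with common prefix x is the pair
   of innermost branches at x.

   If w is Sturmian, it is balanced (Coven-Hedlund) and every factor can be extended
   to the left. By balance, {u | 0u factor} lies above {u | 1u factor}, so deleting a
   common first letter keeps a pair consecutive; the only other pair is 0u, 1u' with u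
   greatest and u' least, and then u = 1m, u' = 0m, because a first disagreement
   between the two tails would produce a second right special word.

   Conversely, under the swap rule the number of ones is nondecreasing along the
   lexicographic order, and grows exactly at the steps x0, x1. A length without right
   special words would make this number constant for two successive lengths, hence w
   constant. Nested gaps give an infinite word m such that x01m and x10m have all
   their prefixes in Fact(w) for every right special x. No suffix of w exceeds 1m or is
   below 0m, otherwise w would be ultimately periodic; so factors of equal length have
   numbers of ones differing by at most one, which leaves room for a single right
   special word of each length. *)

(** Keeps only the comparisons and equations of natural numbers, so that [lia] does not process the
    rest of a large context. *)
Ltac nat_lia :=
  repeat match goal with
  | H : ?P |- _ => lazymatch P with
    | is_true (leq _ _) => fail
    | @eq nat _ _ => fail
    | nat => fail
    | _ => clear H
    end
  end; lia.

(** * Factors as windows of a binary word *)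

Definition agree (T : Type) (w : nat -> T) (i j n : nat) : Prop :=
  forall k, k < n -> w (i + k) = w (j + k).

(* The window of length k at i is right special, and is followed by 0 at i, by 1 at j. *)
Definition branch (b : nat -> bool) (i j k : nat) : Prop :=
  [/\ agree b i j k, b (i + k) = false & b (j + k) = true].

Definition below (b : nat -> bool) (i j n : nat) : Prop :=
  exists2 k, k < n & branch b i j k.

Definition consecutive (b : nat -> bool) (i j n : nat) : Prop :=
  below b i j n /\ ~ exists f, below b i f n /\ below b f j n.

(* The condition of the theorem on pairs of windows: x is the window of length k at i,
   and the two windows are x0, x1 or x01u, x10u. *)
Definition swap_rule (b : nat -> bool) : Prop :=
  forall i j n, consecutive b i j n ->
  exists k, [/\ k < n, branch b i j k &
    k.+1 = n \/ [/\ b (i + k.+1) = true, b (j + k.+1) = false &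
                    agree b (i + k.+2) (j + k.+2) (n - k.+2)]].

Definition has_branch (b : nat -> bool) : Prop :=
  forall n, exists i j, branch b i j n.

(** With [has_branch] this says that each length has exactly one right special word. *)
Definition unique_branch (b : nat -> bool) : Prop :=
  forall n i j i' j', branch b i j n -> branch b i' j' n -> agree b i i' n.

Fixpoint ones (b : nat -> bool) (i n : nat) : nat :=
  if n is n'.+1 then b i + ones b i.+1 n' else 0.

Lemma agree_sym (T : Type) (w : nat -> T) i j n : agree w i j n -> agree w j i n.
Proof. by move=> h k /h. Qed.

Lemma agree_trans (T : Type) (w : nat -> T) i j l n :
  agree w i j n -> agree w j l n -> agree w i l n.
Proof. by move=> h h' k kn; rewrite h // h'. Qed.

Lemma agree_le (T : Type) (w : nat -> T) i j m n :
  m <= n -> agree w i j n -> agree w i j m.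
Proof. by move=> mn h k km; apply: h; apply: leq_trans mn. Qed.

Lemma agree_cons (T : Type) (w : nat -> T) i j n :
  w i = w j -> agree w i.+1 j.+1 n -> agree w i j n.+1.
Proof. by move=> e h [|k] kn; rewrite ?addn0 // !addnS -!addSn h. Qed.

Lemma agree_rcons (T : Type) (w : nat -> T) i j n :
  agree w i j n -> w (i + n) = w (j + n) -> agree w i j n.+1.
Proof.
move=> h e k; rewrite ltnS leq_eqVlt => /orP[/eqP->//|]; exact: h.
Qed.

Lemma agree_behead (T : Type) (w : nat -> T) i j n :
  agree w i j n.+1 -> agree w i.+1 j.+1 n.
Proof. by move=> h k kn; rewrite !addSnnS h. Qed.

Lemma branch_behead b i j k : branch b i j k.+1 -> branch b i.+1 j.+1 k.
Proof. by case=> h h0 h1; split; rewrite ?addSnnS //; apply: agree_behead. Qed.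

Lemma branch_cons b i j k : b i = b j -> branch b i.+1 j.+1 k -> branch b i j k.+1.
Proof. by move=> e [h]; rewrite !addSnnS => h0 h1; split=> //; apply: agree_cons. Qed.

Lemma branch_inj b i j k k' : branch b i j k -> branch b i j k' -> k = k'.
Proof.
move=> [h h0 h1] [h' h0' h1']; case: (ltngtP k k') => // kk.
  by have := h' _ kk; rewrite h0 h1.
by have := h _ kk; rewrite h0' h1'.
Qed.

Lemma agreeVbelow b i j n : [\/ agree b i j n, below b i j n | below b j i n].
Proof.
elim: n => [|n [h|[k kn h]|[k kn h]]]; first by apply: Or31.
- case e: (b (i + n)); case e': (b (j + n)).
  + by apply: Or31; apply: agree_rcons => //; rewrite e e'.
  + by apply: Or33; exists n => //; split=> //; apply: agree_sym.
  + by apply: Or32; exists n.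
  + by apply: Or31; apply: agree_rcons => //; rewrite e e'.
- by apply: Or32; exists k => //; lia.
- by apply: Or33; exists k => //; lia.
Qed.

Lemma below_le b i j m n : m <= n -> below b i j m -> below b i j n.
Proof. by move=> mn [k km h]; exists k => //; lia. Qed.

Lemma below_agreel b i i' j n : agree b i i' n -> below b i j n -> below b i' j n.
Proof.
move=> e [k kn [h h0 h1]]; exists k => //; split=> //; last by rewrite -e.
by apply: agree_trans h; apply/agree_sym/agree_le/e; lia.
Qed.

Lemma below_agreer b i j j' n : agree b j j' n -> below b i j n -> below b i j' n.
Proof.
move=> e [k kn [h h0 h1]]; exists k => //; split=> //; last by rewrite -e.
by apply: agree_trans h _; apply/agree_le/e; lia.
Qed.

(* The window read as a binary number, so that chains below two given windows are finite. *)
Fixpoint rank (b : nat -> bool) (i n : nat) : nat :=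
  if n is n'.+1 then b (i + n') + (rank b i n').*2 else 0.

Lemma rank_agree b i j n : agree b i j n -> rank b i n = rank b j n.
Proof. by elim: n => //= n IH h; rewrite h // IH //; apply: agree_le h. Qed.

Lemma rank_below b i j n : below b i j n -> rank b i n < rank b j n.
Proof.
elim: n => [|n IH] [k] //=; rewrite ltnS leq_eqVlt => /orP[/eqP-> [h -> ->]|kn h].
  by rewrite (rank_agree h); lia.
have /IH : below b i j n by exists k.
by case: (b (i + n)); case: (b (j + n)); lia.
Qed.

(** A pair that is not consecutive splits at an intermediate window into two pairs with smaller
    difference of ranks, so a transitive relation need only be checked on consecutive pairs. *)
Lemma chain_ind b n (P : nat -> nat -> Prop) :
  (forall i f j, P i f -> P f j -> P i j) ->
  (forall i j, consecutive b i j n -> P i j) -> forall i j, below b i j n -> P i j.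
Proof.
move=> Ptr Pn i j.
have [d] := ubnP (rank b j n - rank b i n); elim: d i j => // d IH i j hd h.
have [[f [h1 h2]]|nf] := pselect (exists f, below b i f n /\ below b f j n).
  have := rank_below h1; have := rank_below h2 => r1 r2.
  by apply: (Ptr _ f); apply: IH => //; lia.
by apply: Pn.
Qed.

(** An intermediate window also starts with the common prefix; its next letter tells which end of
    the pair it replaces, and the difference of ranks drops. *)
Lemma consecutive_branch b i j k n : k < n -> branch b i j k ->
  exists p q, [/\ consecutive b p q n, agree b p i k & branch b p q k].
Proof.
move=> kn.
have [d] := ubnP (rank b j n - rank b i n); elim: d i j => // d IH i j hd h.
have [[f [h1 h2]]|nf] := pselect (exists f, below b i f n /\ below b f j n); last first.
  by exists i, j; split=> //; split=> //; exists k.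
have := rank_below h1; have := rank_below h2 => r1 r2.
case: (h) => hij h0 h1'.
(* a word squeezed between two words with common prefix x has prefix x *)
have e : agree b i f k.
  case: h1 h2 => [k1 k1n [e1 e10 e11]] [k2 k2n [e2 e20 e21]].
  have [kk1|k1k] := leqP k k1; first exact: agree_le e1.
  have [k21|k12|k12] := ltngtP k2 k1.
  - by have := hij k2; rewrite e1 // e20 e21 => /(_ ltac:(lia)).
  - by have := hij k1; rewrite -e2 // e10 e11 => /(_ ltac:(lia)).
  - by move: e20; rewrite k12 e11.
case ef: (b (f + k)).
  by apply: (IH i f) => //; first lia.
have hfj : branch b f j k.
  by split=> //; apply: agree_trans hij; apply: agree_sym.
have [|p [q [hn hp hb]]] := IH f j _ hfj; first lia.
exists p, q; split=> //; exact: agree_trans hp (agree_sym e).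
Qed.

(** * Numbers of ones and aperiodicity *)

Lemma onesD b i m n : ones b i (m + n) = ones b i m + ones b (i + m) n.
Proof. by elim: m i => [|m IH] i /=; rewrite ?addn0 // IH addSnnS addnA. Qed.

Lemma ones_rcons b i n : ones b i n.+1 = ones b i n + b (i + n).
Proof. by rewrite -addn1 onesD /= addn0. Qed.

Lemma ones_agree b i j n : agree b i j n -> ones b i n = ones b j n.
Proof.
elim: n i j => //= n IH i j h; rewrite (IH _ j.+1); last exact: agree_behead.
by have := h 0 isT; rewrite !addn0 => ->.
Qed.

Lemma ones_negb b i n : ones (negb \o b) i n + ones b i n = n.
Proof. by elim: n i => //= n IH i; have := IH i.+1; case: (b i) => /=; lia. Qed.

Lemma ones_branch b i j k : branch b i j k -> ones b j k.+1 = (ones b i k.+1).+1.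
Proof. by case=> h h0 h1; rewrite !ones_rcons h0 h1 (ones_agree h); lia. Qed.

(** Two occurrences of a right special word of length [i0 + p] agree at offset [i0]; a period [p]
    would carry this to offset [i0 + p], where they differ. *)
Lemma aperiodic b i0 p : has_branch b -> 0 < p ->
  ~ (forall k, i0 <= k -> b (k + p) = b k).
Proof.
move=> hb p0 per; have [i [j [h h0 h1]]] := hb (i0 + p).
have := per (i + i0); have := per (j + i0); rewrite -!addnA h0 h1 h; last lia.
by move=> e1 e2; have := e1 ltac:(lia); have := e2 ltac:(lia) => <-.
Qed.


(** * The swap rule forces a unique right special word *)

Lemma swap_rule_ones_consecutive b i j n : swap_rule b -> consecutive b i j n ->
  ones b i n = ones b j n \/
  ones b j n = (ones b i n).+1 /\ exists2 k, k.+1 = n & branch b i j k.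
Proof.
move=> sr /sr [k [kn h or_end]].
have [<-|nk] := eqVneq k.+1 n.
  by right; split; [exact: ones_branch | exists k].
case: or_end => [/eqP|[e1 e2 e]]; first by rewrite (negPf nk).
left; have [hk h0 h1] := h.
have split_ones x : ones b x n =
    ones b x k + (b (x + k) + (b (x + k.+1) + ones b (x + k.+2) (n - k.+2))).
  by rewrite [in LHS](_ : n = k + (n - k.+2).+2) ?onesD /= -?addnS //; lia.
by rewrite !split_ones e1 e2 h0 h1 (ones_agree hk) (ones_agree e).
Qed.

Lemma swap_rule_ones_below b i j n : swap_rule b -> below b i j n ->
  ones b i n <= ones b j n.
Proof.
move=> sr; move: i j; apply: chain_ind => [i f j|i j].
  exact: leq_trans.
by move=> /(swap_rule_ones_consecutive sr) [->|[-> _]].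
Qed.

(** Tails of right special words are right special, so a length [n] without them makes the number of
    ones constant on windows of length [n.+1] and also of length [n.+2]. A window starting with 0
    and one starting with 1 contradict this. *)
Lemma swap_rule_has_branch b : swap_rule b ->
  (exists i, b i = false) -> (exists i, b i = true) -> has_branch b.
Proof.
move=> sr [i0 bi0] [i1 bi1] n; apply: contrapT => nb.
have const m : ~ (exists i j, branch b i j m) ->
    forall i j, ones b i m.+1 = ones b j m.+1.
  move=> nbm.
  have eq_below : forall i j, below b i j m.+1 -> ones b i m.+1 = ones b j m.+1.
    apply: chain_ind => [i f j -> //|i j].
    move=> /(swap_rule_ones_consecutive sr) [//|[_ [k [km] hk]]].
    by case: nbm; exists i, j; rewrite -km.
  move=> i j; by case: (agreeVbelow b i j m.+1) => [/ones_agree|/eq_below|/eq_below].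
have nb' : ~ (exists i j, branch b i j n.+1).
  by move=> [i [j /branch_behead h]]; apply: nb; exists i.+1, j.+1.
have := const _ nb' i0 i1; rewrite [LHS]/= [RHS]/= -!/(ones _ _ n.+1).
by have := const _ nb i0.+1 i1.+1; rewrite /= bi0 bi1; lia.
Qed.

(** The infinite word 1m; accordingly [negb \o one_cons (negb \o m)] is 0m. *)
Definition one_cons (m : nat -> bool) (k : nat) : bool :=
  if k is k'.+1 then m k' else true.

Definition prefix_at (b : nat -> bool) (p : nat) (f : nat -> bool) (n : nat) : Prop :=
  forall k, k < n -> b (p + k) = f k.

(* The suffix of b starting at i is lexicographically greater than 1m. *)
Definition above_one_cons (b m : nat -> bool) (i : nat) : Prop :=
  exists k, [/\ prefix_at b i (one_cons m) k, one_cons m k = false & b (i + k) = true].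

(* x01m and x10m bound the gap at every right special x; 01m is the greatest word
   starting with 0, and 10m the least one starting with 1 (the last two clauses are
   exchanged by complementing the letters). *)
Definition gap_tail (b m : nat -> bool) : Prop :=
  [/\ forall i j k n, branch b i j k -> exists p q,
        [/\ consecutive b p q (k.+2 + n), agree b p i k, branch b p q k,
            b (p + k.+1) = true /\ b (q + k.+1) = false &
            prefix_at b (p + k.+2) m n /\ prefix_at b (q + k.+2) m n],
      forall i k, b i = false -> prefix_at b i.+1 (one_cons m) k ->
        one_cons m k = false -> b (i.+1 + k) = false &
      forall i k, b i = true -> prefix_at b i.+1 (negb \o one_cons (negb \o m)) k ->
        one_cons (negb \o m) k = false -> b (i.+1 + k) = true].

(** The gap at the empty word lies between the greatest window starting with 0 and the least one
    starting with 1. By the swap rule these are 01u and 10u, and u grows to the infinite word m with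
    the length. *)
Lemma swap_rule_gap_tail b : swap_rule b ->
  (exists i, b i = false) -> (exists i, b i = true) -> exists m, gap_tail b m.
Proof.
move=> sr [i0 bi0] [i1 bi1].
have gap i j k n : branch b i j k -> exists p q,
   [/\ consecutive b p q (k.+2 + n), agree b p i k, branch b p q k,
       b (p + k.+1) = true /\ b (q + k.+1) = false &
       agree b (p + k.+2) (q + k.+2) n].
  move=> h; have [|p [q [hn hp hb]]] := @consecutive_branch b i j k (k.+2 + n) _ h; first lia.
  exists p, q; have [k' [k'n hb' c]] := sr _ _ _ hn.
  have ek := branch_inj hb hb'; subst k'.
  case: c => [|[e1 e2]]; first lia.
  by rewrite addKn => e.
have h01 : branch b i0 i1 0 by split=> //; rewrite addn0.
have /choice [s hs] : forall n, exists s, exists t,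
   [/\ consecutive b s t (2 + n), b s = false, b t = true,
     b s.+1 = true /\ b t.+1 = false &
     agree b s.+2 t.+2 n].
  move=> n; have [s [t [h1 _ [_ h2 h3] [h4 h5] h6]]] := gap _ _ _ n h01.
  by exists s, t; move: h2 h3 h4 h5 h6; rewrite !addn0 !addn1 !addn2.
have {hs}/choice [t hst] := hs.
have max0 n i : b i = false -> ~ below b (s n) i (2 + n).
  move=> bi h; have [[_ nf] _ bt _ _] := hst n.
  by apply: nf; exists i; split=> //; exists 0 => //; split=> //; rewrite addn0.
have min1 n i : b i = true -> ~ below b i (t n) (2 + n).
  move=> bi h; have [[_ nf] bs _ _ _] := hst n.
  by apply: nf; exists i; split=> //; exists 0 => //; split=> //; rewrite addn0.
(* Of two greatest windows starting with 0, the longer extends the shorter. *)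
have coh n n' : n <= n' -> agree b (s n) (s n') (2 + n).
  move=> nn; have [_ bs _ _ _] := hst n; have [_ bs' _ _ _] := hst n'.
  case: (agreeVbelow b (s n) (s n') (2 + n)) => // h; first by case: (max0 n _ bs').
  by case: (max0 n' _ bs); apply: below_le h; lia.
(* The window at [s n] shows [n] letters after 01, so [n = k.+1] is the first index that reaches
   letter [k]. *)
pose m k := b ((s k.+1).+2 + k).
have sm n : prefix_at b (s n).+2 m n.
  move=> k kn; rewrite /m; have := @coh k.+1 n ltac:(lia) k.+2.
  by rewrite !addSnnS => -> //; lia.
have tm n : prefix_at b (t n).+2 m n.
  by move=> k kn; have [_ _ _ _ <- //] := hst n; apply: sm.
exists m; split.
- move=> i j k n h; have [p [q [hn hp hb [e1 e2] ha]]] := gap _ _ _ n h.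
  exists p, q; split=> //.
  have [_ bp bq] := hb.
  move: ha e1 e2; rewrite !addnS => ha e1 e2.
  (* At x the pair is x01u, x10u. Here 01u is at most the greatest window starting with 0, and 10u
     at least the least one starting with 1, which bounds u by m on both sides. *)
  have sp : agree b (s n).+2 (p + k).+2 n.
    have [_ bs bt [bs1 bt1] sta] := hst n.
    have lift x y z : b x = b y -> b x.+1 = b y.+1 -> z < n ->
        branch b x.+2 y.+2 z -> below b x y (2 + n).
      move=> ex ex1 zn h'; exists z.+2; first nat_lia.
      by do 2?apply: branch_cons.
    case: (agreeVbelow b (s n).+2 (p + k).+2 n) => // [] [z zn hz].
      by case: (max0 n (p + k) bp); apply: (lift _ _ z) => //; rewrite ?bs ?bs1.
    case: (min1 n (q + k) bq); apply: (lift _ _ z); rewrite ?bt ?bt1 //.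
    have zn' := ltnW zn.
    case: hz => c0 c1 c2; split.
    + apply: agree_trans (agree_sym (agree_le zn' ha)) _.
      by apply: agree_trans c0 _; apply: agree_le zn' sta.
    + by rewrite -ha.
    + by rewrite -sta.
  split=> z zn; first by rewrite -sp // sm.
  by rewrite -ha // -sp // sm.
- move=> i k bi hp ok; case bk: (b (i.+1 + k)) => //.
  have [_ bs _ [bs1 _] _] := hst k.
  case: k ok bk hp bs bs1 => [|k] //= mk bk hp bs bs1.
  case: (max0 k.+1 i bi); exists k.+2; first nat_lia.
  have bi1' : b i.+1 = true by have := hp 0 isT; rewrite addn0.
  apply: branch_cons; first by rewrite bs bi.
  apply: branch_cons; first by rewrite bs1 bi1'.
  split; last by rewrite addSnnS.
    move=> z zk; rewrite sm; last nat_lia.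
    by rewrite addSnnS hp //; nat_lia.
  by rewrite sm.
- move=> i k bi hp ok; case bk: (b (i.+1 + k)) => //.
  have [_ _ bt [_ bt1] _] := hst k.
  case: k ok bk hp bt bt1 => [|k] //= /negbFE mk bk hp bt bt1.
  case: (min1 k.+1 i bi); exists k.+2; first nat_lia.
  have bi1' : b i.+1 = false by have := hp 0 isT; rewrite addn0.
  apply: branch_cons; first by rewrite bt bi.
  apply: branch_cons; first by rewrite bt1 bi1'.
  split; first 1 last.
  + by rewrite addSnnS.
  + by rewrite tm.
  move=> z zk; rewrite tm; last nat_lia.
  by rewrite addSnnS hp //= ?negbK //; nat_lia.
Qed.

(** * Exchange of the two letters *)

Lemma branch_negb b i j k : branch (negb \o b) i j k <-> branch b j i k.
Proof.
split=> [] [h h0 h1]; split.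
- by move=> z /h /= /negb_inj.
- by apply/negbTE.
- by apply/negbFE.
- by move=> z /h /= ->.
- by rewrite /= h1.
- by rewrite /= h0.
Qed.

Lemma below_negb b i j n : below (negb \o b) i j n <-> below b j i n.
Proof. by split=> [] [k kn /branch_negb h]; exists k. Qed.

Lemma consecutive_negb b i j n : consecutive (negb \o b) i j n <-> consecutive b j i n.
Proof.
split=> [] [/below_negb h nf]; split=> // [] [f [h1 h2]]; apply: nf; exists f.
  by split; apply/below_negb.
by split; apply/below_negb.
Qed.

Lemma negb_comp2 (f : nat -> bool) : negb \o (negb \o f) = f.
Proof. by apply/funext => k /=; rewrite negbK. Qed.

Lemma gap_tail_negb b m : gap_tail b m -> gap_tail (negb \o b) (negb \o m).
Proof.
move=> [g mx mn]; split.
- move=> i j k n /branch_negb h; have [q [p [hn qj hb [e1 e2] [h1 h2]]]] := g _ _ _ n h.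
  have [qp _ _] := hb.
  exists p, q; split.
  + exact/consecutive_negb.
  + have [ij _ _] := h.
    move=> z zk /=; congr negb; by rewrite -qp // qj // ij.
  + exact/branch_negb.
  + by rewrite /= e1 e2.
  + by split=> z zn /=; rewrite ?h1 ?h2.
- move=> i k /negbFE bi hp ok; apply/negbTE; rewrite negbK.
  apply: (mn i k bi) => //.
  by move=> z /hp /= <-; rewrite negbK.
- move=> i k /negbTE bi hp ok; rewrite negb_comp2 in hp ok.
  rewrite /=; apply/negbT; apply: (mx i k) => //.
  by move=> z /hp /= /negb_inj.
Qed.

(** * Suffixes exceeding 1m *)

Lemma above_trans b m i p k n : prefix_at b i (one_cons m) k ->
  one_cons m k = false -> b (i + k) = true -> k < n -> ~ below b p i n ->
  above_one_cons b m p.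
Proof.
move=> hi mk bk kn nb.
case: (agreeVbelow b i p n) => [h|[z zn [h h0 h1]]|//].
  exists k; split=> //; last by rewrite -h.
  by move=> z zk; rewrite -h ?hi //; nat_lia.
have [kz|kz|kz] := ltngtP k z.
- exists k; split=> //; last by rewrite -h.
  by move=> y yk; rewrite -h ?hi //; nat_lia.
- exists z; split=> //; last by rewrite -hi.
  by move=> y yk; rewrite -h ?hi //; nat_lia.
- by rewrite -kz bk in h0.
Qed.

(** A preceding 0 is excluded because 01m is greatest among the words starting with 0; a preceding 1
    puts a 1 where 1m has its first zero. *)
Lemma above_descent b m i : gap_tail b m -> above_one_cons b m i.+1 ->
  b i = true /\ above_one_cons b m i.
Proof.
move=> [_ mx _] [k [hp mk bk]].
have bi : b i = true.
  by case e: (b i) => //; move: bk; rewrite (mx i k).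
split=> //.
(* [a] is the first zero of [1m]: then [m] starts with [1^(a-1) 0], so [m <= 1m] *)
have exa : exists a, ~~ one_cons m a by exists k; rewrite mk.
case: (ex_minnP exa) => [] [//|a] /negbTE ma amin.
have ak : a.+1 <= k by apply: amin; rewrite mk.
have m1 z : z <= a -> one_cons m z = true.
  by move=> za; apply: contraTT za => /amin; nat_lia.
exists a.+1; split=> //.
  move=> [|z] za; first by rewrite addn0 bi.
  by rewrite -addSnnS hp ?m1 //; nat_lia.
by rewrite -addSnnS hp ?m1 //; nat_lia.
Qed.

Lemma above_ones b m p : gap_tail b m -> above_one_cons b m p ->
  forall t, t <= p -> b t = true.
Proof.
move=> g; elim: p => [|p IH] h t tp.
  case: h => [] [|k] [hp mk bk] //; have -> : t = 0 + 0 by nat_lia.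
  by rewrite hp.
have [bp h'] := above_descent g h.
case: (ltngtP t p.+1) tp => // [tp|->] _; first by apply: IH.
case: h => [] [|k] [hp mk bk] //; rewrite -(addn0 p.+1).
by rewrite hp.
Qed.

(** Otherwise [b] starts with ones beyond [p], up to its first zero [K], and some power of 1 is
    right special. Both sides of its gap exceed 1m, hence have only ones before them and meet their
    first zero at [K]. Reading m after each makes the letters from [K.+1] on constant. *)
Lemma above_eq0 b m p : gap_tail b m -> has_branch b ->
  (exists i, b i = false) -> above_one_cons b m p -> p = 0.
Proof.
move=> g hb [i0 bi0]; case: p => // q hq.
have exK : exists K, ~~ b K by exists i0; rewrite bi0.
case: (ex_minnP exK) => K /negbTE bK Kmin.
have b1 z : z < K -> b z = true.
  by move=> zK; apply: contraTT zK => /Kmin; nat_lia.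
(* All letters before a suffix exceeding 1m are ones, so its first zero is the first zero of [b]. *)
have start p c : above_one_cons b m p -> (forall z, z < c -> b (p + z) = true) ->
    b (p + c) = false -> p + c = K.
  move=> hp hc bpc.
  have pc z : z < p + c -> b z = true.
    move=> zpc; have [zp|pz] := leqP z p; first exact: (above_ones g hp).
    have -> : z = p + (z - p) by nat_lia.
    by rewrite hc //; nat_lia.
  have := Kmin (p + c); rewrite bpc => /(_ isT) Kpc.
  have [//|KK] := leqP (p + c) K; first by nat_lia.
  by move: bK; rewrite pc.
have qK : q.+1 < K.
  rewrite ltnNge; apply/negP => Kq.
  by move: bK; rewrite (above_ones g hq).
pose j := K - q.+1.
have eK : q.+1 + j = K by rewrite /j; nat_lia.
have hbr : branch b q.+1 q j.
  split; [|by rewrite eK|by apply: b1; nat_lia].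
  by move=> z zj; rewrite !b1 //; nat_lia.
have [g1 _ _] := g.
have [k [hk mk bk]] := hq.
have tails n : [/\ b K.+1 = true, prefix_at b K.+2 m n & prefix_at b K.+1 m n].
  have [p1 [p2 [hn hp1 hb12 [e1 e2] [t1 t2]]]] := g1 _ _ _ (n + k) hbr.
  have [h12 b10 b21] := hb12.
  have q2 : below b q.+1 p2 (j.+2 + (n + k)).
    exists j; first nat_lia.
    by split=> //; [apply: agree_trans h12; apply: agree_sym | rewrite eK].
  have a1 : above_one_cons b m p1.
    apply: (above_trans hk mk bk (n := j.+2 + (n + k))); first nat_lia.
    by move=> h; case: hn => _ []; exists q.+1; split.
  have a2 : above_one_cons b m p2.
    apply: (above_trans hk mk bk (n := j.+2 + (n + k))); first nat_lia.
    by move=> /rank_below; have := rank_below q2; nat_lia.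
  have ones1 z : z < j -> b (p1 + z) = true by move=> zj; rewrite hp1 // b1; nat_lia.
  have E1 := start _ _ a1 ones1 b10.
  have E2 : p2 + j.+1 = K.
    apply: start => // z; rewrite ltnS leq_eqVlt => /orP[/eqP-> //|zj].
    by rewrite -h12 // ones1.
  split.
  - by rewrite -E1 -addnS.
  - by move=> z zn; rewrite -E1 -!addnS t1 //; nat_lia.
  - by move=> z zn; rewrite -E2 -!addnS t2 //; nat_lia.
case: (@aperiodic b K.+1 1 hb isT) => x Kx.
have [_ h2 h1] := tails (x - K.+1).+1.
have {1}-> : x + 1 = K.+2 + (x - K.+1) by nat_lia.
have {2}-> : x = K.+1 + (x - K.+1) by nat_lia.
by rewrite h1 // h2.
Qed.

(** Only [b] itself could exceed 1m, first at some [k]. The prefix x of length [k] is then right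
    special with gap x01m, x10m. The upper side exceeds 1m, so it occurs at 0; the lower side is 1m
    itself. Thus 1m = x01m has period [k.+1], and m is a suffix of [b]. *)
Lemma not_above b m i : gap_tail b m -> has_branch b ->
  (exists i, b i = false) -> ~ above_one_cons b m i.
Proof.
move=> g hb b0 hi.
have i0 := above_eq0 g hb b0 hi; subst i.
have [k [hk mk bk]] := hi; rewrite add0n in bk.
have [g1 _ _] := g.
have [z0 [z1 z01]] := hb 0.
(* The gap at the empty word provides 01m, hence 1m, to any length. *)
have carry n : exists s, prefix_at b s (one_cons m) n.
  have [p [_ [_ _ _ [e1 _] [t1 _]]]] := g1 _ _ _ n z01.
  rewrite addn1 in e1; rewrite addn2 in t1.
  exists p.+1 => [] [|z] zn; first by rewrite addn0 e1.
  by rewrite -addSnnS t1 //; nat_lia.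
have [s1 hs1] := carry k.+1.
have hbr : branch b s1 0 k.
  split=> //; last by rewrite hs1.
  by move=> z zk; rewrite hk // hs1 //; nat_lia.
have tails n : [/\ one_cons m k.+1 = true, forall t, t < n -> one_cons m (k.+2 + t) = m t
    & prefix_at b k.+2 m n].
  have [p1 [p2 [hn hp1 hb12 [e1 e2] [t1 t2]]]] := g1 _ _ _ n hbr.
  have [h12 b10 b21] := hb12.
  have a2 : above_one_cons b m p2.
    exists k; split=> // z zk; rewrite -h12 // hp1 // hs1 //; nat_lia.
  have p20 := above_eq0 g hb b0 a2; subst p2.
  have [s hs] := carry (k.+2 + n).
  have agr : agree b p1 s (k.+2 + n).
    case: (agreeVbelow b p1 s (k.+2 + n)) => // [h|[z zn [h h0 h1]]].
      case: hn => _ []; exists s; split=> //; exists k; first nat_lia.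
      split=> //; last by rewrite hs //; nat_lia.
      by move=> z zk; rewrite hk // hs //; nat_lia.
    have a1 : above_one_cons b m p1.
      exists z; split=> //; last by rewrite -hs.
      by move=> y yz; rewrite -h // hs //; nat_lia.
    have p10 := above_eq0 g hb b0 a1; subst p1.
    by rewrite b10 in b21.
  split=> //.
  - by rewrite -hs -?agr //; nat_lia.
  - by move=> t tn; rewrite -hs -?agr ?addnA ?t1 //; nat_lia.
apply: (@aperiodic b k.+2 k.+1 hb isT) => x kx.
have [_ h2 h1] := tails (x + k.+1).
have -> : x + k.+1 = k.+2 + (k.+1 + (x - k.+2)) by nat_lia.
have {2}-> : x = k.+2 + (x - k.+2) by nat_lia.
rewrite !h1; [|nat_lia|nat_lia].
by have := h2 (x - k.+2); apply; nat_lia.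
Qed.

(** Every window lies between the prefixes of 0m and 1m of its length, which are factors and differ
    by a single one; the number of ones is monotone. *)
Lemma swap_rule_ones_le b i j n : swap_rule b ->
  (exists i, b i = false) -> (exists i, b i = true) ->
  ones b j n <= (ones b i n).+1.
Proof.
move=> sr b0 b1; have [m g] := swap_rule_gap_tail sr b0 b1.
have hb := swap_rule_has_branch sr b0 b1.
have g' := gap_tail_negb g.
have hb' : has_branch (negb \o b).
  by move=> k; have [x [y h]] := hb k; exists y, x; apply/branch_negb.
have b0' : exists i, (negb \o b) i = false by have [x hx] := b1; exists x; rewrite /= hx.
case: n => // n.
have [z0 [z1 z01]] := hb 0; have [g1 _ _] := g.
have [p [q [_ _ [_ bp bq] [e1 e2] [t1 t2]]]] := g1 _ _ _ n z01.
rewrite !addn1 in e1 e2; rewrite !addn2 in t1 t2.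
rewrite addn0 in bp bq.
have pq : ones b p.+1 n.+1 = (ones b q.+1 n.+1).+1.
  rewrite /= e1 e2 (@ones_agree _ _ q.+2) //.
  by move=> z zn; rewrite t1 ?t2.
have jp : ones b j n.+1 <= ones b p.+1 n.+1.
  case: (agreeVbelow b j p.+1 n.+1) => [/ones_agree-> //|/(swap_rule_ones_below sr)//|].
  move=> [z zn [h h0 h1]]; case: (not_above g hb b0 (i := j)).
  have hz y : y <= z -> b (p.+1 + y) = one_cons m y.
    case: y => [|y] yz; first by rewrite addn0 e1.
    by rewrite -addSnnS t1 //; nat_lia.
  exists z; split=> //; last by rewrite -hz.
  by move=> y yz; rewrite -h // hz //; nat_lia.
have iq : ones b q.+1 n.+1 <= ones b i n.+1.
  case: (agreeVbelow b q.+1 i n.+1) => [/ones_agree-> //|/(swap_rule_ones_below sr)//|].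
  move=> [z zn [h h0 h1]]; case: (not_above g' hb' b0' (i := i)).
  have hz y : y <= z -> ~~ b (q.+1 + y) = one_cons (negb \o m) y.
    case: y => [|y] yz; first by rewrite addn0 e2.
    by rewrite -addSnnS t2 //; nat_lia.
  exists z; split=> //; last by rewrite /= h0.
    by move=> y yz /=; rewrite h // hz //; nat_lia.
  by rewrite -hz // h1.
nat_lia.
Qed.

(** For right special words x below y of equal length, x0, x1, y0, y1 would increase and gain at
    least two ones. *)
Lemma swap_rule_unique_branch b : swap_rule b ->
  (exists i, b i = false) -> (exists i, b i = true) -> unique_branch b.
Proof.
move=> sr b0 b1.
have low n i j i' j' : branch b i j n -> branch b i' j' n -> ~ below b i i' n.
  move=> h h' hii.
  have := ones_branch h; have := ones_branch h'.
  have := swap_rule_ones_le i j' n.+1 sr b0 b1.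
  have : below b j i' n.+1.
    apply: (@below_le _ _ _ n) => //; apply: below_agreel hii; by case: h.
  by move=> /(swap_rule_ones_below sr); nat_lia.
move=> n i j i' j' h h'; case: (agreeVbelow b i i' n) => // hh.
  by case: (low _ _ _ _ _ h h' hh).
by case: (low _ _ _ _ _ h' h hh).
Qed.

(** * Sturmian words satisfy the swap rule *)

(* There are at most n + 1 factors of length n, in pigeonhole form. *)
Definition few_words (b : nat -> bool) : Prop :=
  forall n (f : nat -> nat), exists x y, [/\ x < y, y <= n.+1 & agree b (f x) (f y) n].

(** No word u has both 0u0 and 1u1 as factors, the form that a shortest unbalanced pair takes. *)
Definition balanced (b : nat -> bool) : Prop :=
  forall i j k, branch b i j 0 -> ~ branch b i.+1 j.+1 k.

Lemma unique_branch_agree b i j p q n : unique_branch b -> branch b p q n ->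
  agree b i j n -> b (i + n) <> b (j + n) -> agree b p i n.
Proof.
move=> ub h hij; case e: (b (i + n)); case e': (b (j + n)) => // _.
    apply: (agree_trans _ (agree_sym hij)); apply: (ub _ _ _ _ _ h (_ : branch b j i n)).
  by split=> //; apply: agree_sym.
by apply: (ub _ _ _ _ _ h (_ : branch b i j n)); split.
Qed.

(** Only prefixes of [b] need an argument. If a later copy of the prefix is followed by another
    letter, the prefix is the right special word, which is the tail of a longer right special word
    and so occurs before either letter with a letter in front. *)
Lemma left_extensible b i n : has_branch b -> unique_branch b ->
  exists g, agree b i g.+1 n.
Proof.
move=> hb ub; case: i => [|i]; last by exists i.
elim: n => [|n [g hg]]; first by exists 0.
have [e|ne] := eqVneq (b (0 + n)) (b (g.+1 + n)).
  by exists g; apply: agree_rcons.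
have [x [y /branch_behead h]] := hb n.+1.
have xa := unique_branch_agree ub h hg (elimN eqP ne).
have [xy hx hy] := h.
case e: (b (0 + n)).
  exists y; apply: agree_rcons; last by rewrite hy.
  by apply: agree_trans (agree_sym xa) xy.
exists x; apply: agree_rcons; last by rewrite hx.
exact: agree_sym.
Qed.

(* From [c] on, every window repeats one of the windows between [c] and [c + q],
   so b would be ultimately periodic if none of these were right special. *)
Lemma branch_meets b c q n p p' : has_branch b -> unique_branch b -> branch b p p' n ->
  0 < q -> agree b c (c + q) n -> exists2 s, s < q & agree b p (c + s) n.
Proof.
move=> hb ub h q0 hc; apply: contrapT => nos.
have np s : s < q -> ~ agree b p (c + s) n by move=> sq hs; apply: nos; exists s.
have per t : agree b (c + t) (c + q + t) n /\ exists2 s, s < q & agree b (c + s) (c + t) n.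
  elim/ltn_ind: t => t IH.
  have win : exists2 s, s < q & agree b (c + s) (c + t) n.
    have [tq|qt] := ltnP t q; first by exists t.
    have [|h1 [s sq h2]] := IH (t - q); first nat_lia.
    exists s => //; apply: agree_trans h2 _.
    by have <- : c + q + (t - q) = c + t by nat_lia.
  split=> //; case: t IH win => [|t] IH [s sq hs].
    by rewrite !addn0.
  have [|h1 [s' sq' hs']] := IH t; first by [].
  rewrite !addnS; apply: agree_behead; apply: agree_rcons => //.
  apply: contrapT => ne; case: (np _ sq').
  by apply: agree_trans (unique_branch_agree ub h h1 ne) (agree_sym hs').
apply: (@aperiodic b c q hb q0) => x cx.
have [pt _] := per (x - c); have [|n0] := posnP n; last first.
  have := pt 0 n0; rewrite !addn0.
  have -> : c + q + (x - c) = x + q by nat_lia.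
  by rewrite subnKC.
by move=> n0; case: (np 0 q0); rewrite n0.
Qed.

Lemma ones_negb_le b n : (forall m i j, m < n -> ones b j m <= (ones b i m).+1) ->
  forall m i j, m < n -> ones (negb \o b) j m <= (ones (negb \o b) i m).+1.
Proof.
move=> h m i j mn; have := h m j i mn.
by have := ones_negb b i m; have := ones_negb b j m; nat_lia.
Qed.

Lemma agree_negb b i j n : agree (negb \o b) i j n <-> agree b i j n.
Proof. by split=> h z /h /=; [move/negb_inj | move=> ->]. Qed.

(* [0 u] does not start at a letter of a factor [1 u 1] when [0 u 0] is a factor
   and shorter factors are balanced: overlapping gives [u = s 0 t = t 1 z], and then
   [1 s] and [z 0] are shorter unbalanced factors. *)
Lemma no_overlap b i j k s : (forall m x y, m < k.+2 -> ones b y m <= (ones b x m).+1) ->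
  b i = false -> b j = true -> branch b i.+1 j.+1 k ->
  s <= k.+1 -> ~ agree b i (j + s) k.+1.
Proof.
move=> bal bi bj [hij h0 h1] sk hs.
case: s hs sk => [|s] hs sk.
  by have := hs 0 isT; rewrite !addn0 bi bj.
have bs : b (j + s.+1) = false by have := hs 0 isT; rewrite !addn0 bi.
have sltk : s < k.
  rewrite ltn_neqAle -ltnS sk andbT; apply/eqP => sk'.
  by rewrite sk' -addSnnS h1 in bs.
pose t := k - s.+1.
have e1 := onesD b j.+1 s (1 + t); have e2 := onesD b i.+1 t (1 + s.+1).
have hs' : agree b i.+1 (j.+1 + s.+1) t.
  have := agree_behead hs; rewrite -addSn => h'.
  by apply: agree_le h'; rewrite /t; nat_lia.
have bt : b (i.+1 + t) = true.
  have tk : t.+1 < k.+1 by rewrite /t; nat_lia.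
  rewrite addSnnS hs //; have -> : j + s.+1 + t.+1 = j.+1 + k by rewrite /t; nat_lia.
  by [].
have k1 : s + (1 + t) = k by rewrite /t; nat_lia.
have k2 : t + (1 + s.+1) = k.+1 by rewrite /t; nat_lia.
rewrite k1 /= addSnnS bs in e1.
rewrite k2 ones_rcons h0 in e2.
have := bal s.+1 (i.+1 + t).+1 j _; rewrite ltnS => /(_ ltac:(nat_lia)).
have := ones_agree hij; have := ones_agree hs'.
rewrite [ones b _ (1 + _)]/= bt /= in e2.
rewrite /= bj -addnS; move: e1 e2; rewrite !addSn -!addnS !add0n.
nat_lia.
Qed.

(** A shortest unbalanced pair is 0u0, 1u1, and the right special word one letter longer than u is
    0u or 1u. It must recur within every run of [k.+2] positions, yet [no_overlap] keeps it away
    from such a run. *)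
Lemma few_words_ones_le b : has_branch b -> unique_branch b -> few_words b ->
  forall n i j, ones b j n <= (ones b i n).+1.
Proof.
move=> hb ub fw n; elim/ltn_ind: n => n IH i j; rewrite leqNgt; apply/negP => unb.
have bal m x y : m < n -> ones b y m <= (ones b x m).+1 by move=> mn; apply: IH.
case: n {IH} unb bal => [|[|k]] unb bal; first by [].
  by move: unb; rewrite /=; case: (b i); case: (b j).
have pre m : 0 < m -> m < k.+2 -> ones b j m = (ones b i m).+1.
  move=> m0 mk; have := bal _ i j mk.
  have := bal (k.+2 - m) (i + m) (j + m) ltac:(nat_lia).
  have := onesD b i m (k.+2 - m); have := onesD b j m (k.+2 - m).
  by rewrite subnKC; [nat_lia | exact: ltnW].
have [bi bj] : b i = false /\ b j = true.
  by have := pre 1 isT isT; rewrite /= !addn0; case: (b i); case: (b j).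
have hij : branch b i.+1 j.+1 k.
  split.
  - move=> z zk; have := pre z.+1 isT ltac:(nat_lia); have := pre z.+2 isT ltac:(nat_lia).
    rewrite !(ones_rcons _ _ z.+1) (addSnnS i) (addSnnS j).
    by case: (b (i + _)); case: (b (j + _)) => //=; nat_lia.
  - move: unb; rewrite !(ones_rcons _ _ k.+1) (pre k.+1) // (addSnnS i).
    by case: (b (i + _)); case: (b (j + _)) => //=; nat_lia.
  - move: unb; rewrite !(ones_rcons _ _ k.+1) (pre k.+1) // (addSnnS j).
    by case: (b (i + _)); case: (b (j + _)) => //=; nat_lia.
have [p [p' hp]] := hb k.+1.
have pi := ub _ _ _ _ _ (branch_behead hp) hij.
have [pj _ _] := hij; have {}pj := agree_trans pi pj.
have avoid c : ~ (forall s, s <= k.+1 -> ~ agree b p (c + s) k.+1).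
  move=> no.
  (* Pigeonhole on the [k.+2] windows from [c] on, with index [k.+2] reserved for the right special
     word. *)
  have [x [y [xy yk h]]] := fw k.+1 (fun x => if x == k.+2 then p else c + x).
  move: h; rewrite ltn_eqF; last exact: leq_trans xy yk.
  have [_ /agree_sym|yk2] := eqVneq y k.+2; first by apply: no; nat_lia.
  have -> : c + y = c + x + (y - x) by nat_lia.
  move=> /(branch_meets hb ub hp) => /(_ ltac:(nat_lia)) [s sq].
  by rewrite -addnA; apply: no; nat_lia.
case bp: (b p).
  have pj1 : agree b p j k.+1 by apply: agree_cons; rewrite ?bp ?bj.
  apply: (avoid i) => s sk h.
  apply: (@no_overlap (negb \o b) j i k s (ones_negb_le bal)) => //=.
  - by rewrite bj.
  - by rewrite bi.
  - exact/branch_negb.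
  - exact/agree_negb/(agree_trans (agree_sym pj1) h).
have pi1 : agree b p i k.+1 by apply: agree_cons; rewrite ?bp ?bi.
apply: (avoid j) => s sk h.
exact: (no_overlap bal bi bj hij sk (agree_trans (agree_sym pi1) h)).
Qed.

Lemma few_words_balanced b : has_branch b -> unique_branch b -> few_words b -> balanced b.
Proof.
move=> hb ub fw i j k [_ bi bj] h; rewrite !addn0 in bi bj.
have := few_words_ones_le hb ub fw k.+2 i j.
by have := ones_branch h; rewrite [ones b i _]/= [ones b j k.+2]/= bi bj /=; nat_lia.
Qed.

(** * Consecutive pairs in a balanced word *)

Lemma below_behead b i j n : below b i j n.+1 -> b i = b j -> below b i.+1 j.+1 n.
Proof.
move=> [[|k] kn h] e; last by exists k => //; apply: branch_behead.
by case: h; rewrite !addn0 e => _ ->.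
Qed.

Lemma below_cons b i j n : below b i.+1 j.+1 n -> b i = b j -> below b i j n.+1.
Proof. by move=> [k kn h] e; exists k.+1 => //; apply: branch_cons. Qed.

Lemma below_head b i j n : b i = false -> b j = true -> below b i j n.+1.
Proof. by move=> bi bj; exists 0 => //; split; rewrite ?addn0. Qed.

Lemma balanced_below b i j n : balanced b -> b i = false -> b j = true ->
  ~ below b i.+1 j.+1 n.
Proof. by move=> bal bi bj [k _ h]; apply: (bal i j k) => //; split; rewrite ?addn0. Qed.

(** A window between the tails is extended to the left: the common first letter yields a window
    between the original pair, the other letter contradicts balance. *)
Lemma balanced_consecutive_behead b i j n : has_branch b -> unique_branch b -> balanced b ->
  b i = b j -> consecutive b i j n.+1 -> consecutive b i.+1 j.+1 n.
Proof.
move=> hb ub bal e [h nf]; split; first exact: below_behead h e.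
move=> [f' [h1 h2]]; have [f ff] := left_extensible f' n hb ub.
have {}h1 := below_agreer ff h1; have {}h2 := below_agreel ff h2.
case bf: (b f); case bj: (b j); rewrite bj in e.
- by apply: nf; exists f; split; apply: below_cons; rewrite ?bf ?e ?bj.
- exact: (balanced_below bal e bf h1).
- exact: (balanced_below bal bf bj h2).
- by apply: nf; exists f; split; apply: below_cons; rewrite ?bf ?e ?bj.
Qed.

Lemma balanced_consecutive_head b i j n : has_branch b -> unique_branch b -> balanced b ->
  b i = false -> b j = true -> consecutive b i j n.+2 ->
  [/\ b i.+1 = true, b j.+1 = false & agree b i.+2 j.+2 n].
Proof.
move=> hb ub bal bi bj [h nf].
have maxi f' : ~ below b i.+1 f' n.+1.
  move=> h1; have [f ff] := left_extensible f' n.+1 hb ub.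
  have {}h1 := below_agreer ff h1; case bf: (b f).
    exact: (balanced_below bal bi bf h1).
  apply: nf; exists f; split; first by apply: below_cons; rewrite ?bi ?bf.
  exact: below_head.
have minj f' : ~ below b f' j.+1 n.+1.
  move=> h1; have [f ff] := left_extensible f' n.+1 hb ub.
  have {}h1 := below_agreel ff h1; case bf: (b f); last exact: (balanced_below bal bf bj h1).
  apply: nf; exists f; split; last by apply: below_cons; rewrite ?bj ?bf.
  exact: below_head.
have [x [y [_ bx by_]]] := hb 0; rewrite !addn0 in bx by_.
have bi1 : b i.+1 = true.
  by case e: (b i.+1) => //; case: (maxi y); apply: below_head.
have bj1 : b j.+1 = false.
  by case e: (b j.+1) => //; case: (minj x); apply: below_head.
split=> //.
case: (agreeVbelow b i.+2 j.+2 n) => // [[k kn hk]|].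
  (* The tails branch at a right special v, and the next longer right special word is 1v or 0v. Then
     1v1 exceeds the greatest tail, or 0v0 is below the least one. *)
  have [p [q hpq]] := hb k.+1; have hpq' := branch_behead hpq.
  have [pq _ hq] := hpq; have [_ hp _] := hpq'.
  have pa := ub _ _ _ _ _ hpq' hk; have [hij hi hj] := hk.
  have epq : b p = b q by have := pq 0 isT; rewrite !addn0.
  case bp: (b p).
    case: (maxi q); exists k.+1 => //; apply: branch_cons; first by rewrite bi1 -epq bp.
    split=> //; last by rewrite addSnnS.
    apply: agree_trans (agree_sym pa) _; exact: agree_behead pq.
  case: (minj p); exists k.+1 => //; apply: branch_cons; first by rewrite bj1 bp.
  by split=> //; apply: agree_trans pa hij.
by move=> /(balanced_below bal bj1 bi1).
Qed.

Lemma few_words_swap_rule b : has_branch b -> unique_branch b -> few_words b -> swap_rule b.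
Proof.
move=> hb ub fw; have bal := few_words_balanced hb ub fw.
move=> i j n; elim: n i j => [|n IH] i j hn; first by case: hn => [[]].
have [e|ne] := eqVneq (b i) (b j).
  have [k [kn hk c]] := IH _ _ (balanced_consecutive_behead hb ub bal e hn).
  exists k.+1; split=> //; first exact: branch_cons.
  case: c => [->|[e1 e2 e3]]; first by left.
  by right; move: e1 e2 e3; rewrite !(addSnnS i) !(addSnnS j) subSS.
have h0 : branch b i j 0.
  case: hn => [] [[|k] kn h] _ //; case: h => h _ _.
  by have := h 0 isT; rewrite !addn0 => /eqP; rewrite (negPf ne).
exists 0; split=> //; case: n {IH} hn => [|n] hn; first by left.
case: h0; rewrite !addn0 => _ bi bj.
by right; rewrite !addn1 !addn2 !subSS subn0; apply: balanced_consecutive_head.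
Qed.

(** * From windows to words *)

Definition word (T : Type) (w : nat -> T) (i n : nat) : seq T :=
  [seq w (i + k) | k <- iota 0 n].

Lemma size_word (T : Type) (w : nat -> T) i n : size (word w i n) = n.
Proof. by rewrite size_map size_iota. Qed.

Lemma nth_word (T : Type) x0 (w : nat -> T) i n k : k < n -> nth x0 (word w i n) k = w (i + k).
Proof. by move=> kn; rewrite (nth_map 0) ?size_iota // nth_iota. Qed.

Lemma wordS (T : Type) (w : nat -> T) i n : word w i n.+1 = rcons (word w i n) (w (i + n)).
Proof. by rewrite /word -addn1 iotaD map_cat cats1. Qed.

Lemma wordD (T : Type) (w : nat -> T) i m n : word w i (m + n) = word w i m ++ word w (i + m) n.
Proof.
elim: n => [|n IH]; first by rewrite addn0 cats0.
by rewrite addnS !wordS IH rcons_cat addnA.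
Qed.

Lemma word_factor (T : Type) (w : nat -> T) i n : factor w (word w i n).
Proof. by exists i; rewrite size_word. Qed.

Lemma eq_word (T : Type) (w : nat -> T) i j n : word w i n = word w j n <-> agree w i j n.
Proof.
split=> [h k kn|h].
  by rewrite -(nth_word (w 0) w i kn) h nth_word.
elim: n h => // n IH h; rewrite !wordS IH ?h //; exact: agree_le h.
Qed.

Lemma rcons_factor (T : Type) (w : nat -> T) (u : seq T) a :
  factor w (rcons u a) <-> exists i, u = word w i (size u) /\ a = w (i + size u).
Proof.
split=> [[i]|[i [hu ->]]].
  by rewrite size_rcons -/(word w i _) wordS => /rcons_inj [hu ha]; exists i.
by exists i; rewrite size_rcons -/(word w i _) wordS -hu.
Qed.

Lemma prefix_rcons_word (T : eqType) (w : nat -> T) l a i n :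
  prefix (rcons l a) (word w i n) <->
  [/\ size l < n, l = word w i (size l) & a = w (i + size l)].
Proof.
split.
  move=> h; have ln : size l < n by have := size_prefix h; rewrite size_rcons size_word.
  move: h; have -> : n = (size l).+1 + (n - (size l).+1) by nat_lia.
  rewrite wordD prefixE size_rcons take_size_cat ?size_word // wordS => /eqP/rcons_inj [hl ha].
  by split=> //; nat_lia.
move=> [ln hl ->]; have -> : n = (size l).+1 + (n - (size l).+1) by nat_lia.
by rewrite wordD wordS -hl prefix_prefix.
Qed.

(** * Binary words and the swap condition on factors *)

Definition binary (T : eqType) (zero one : T) (w : nat -> T) : Prop :=
  forall i, w i = zero \/ w i = one.

Definition bit (T : eqType) (one : T) (w : nat -> T) (i : nat) : bool := w i == one.

Lemma bit_inj (T : eqType) (zero one : T) (w : nat -> T) i j : binary zero one w ->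
  bit one w i = bit one w j -> w i = w j.
Proof.
rewrite /bit => h; case: (h i) => ->; case: (h j) => -> //; rewrite eqxx.
  by move=> /eqP.
by move=> /esym /eqP.
Qed.

Lemma agree_bit (T : eqType) (zero one : T) (w : nat -> T) i j n : binary zero one w ->
  agree (bit one w) i j n <-> agree w i j n.
Proof.
by move=> h; split=> h' k /h'; [apply: bit_inj h | rewrite /bit => ->].
Qed.

Lemma branch_bit (T : eqType) (zero one : T) (w : nat -> T) i j n :
  binary zero one w -> zero != one ->
  branch (bit one w) i j n <->
  [/\ agree w i j n, w (i + n) = zero & w (j + n) = one].
Proof.
move=> h z1; have ea := agree_bit i j n h; rewrite /bit in ea *.
split=> [] [/ea h0 h1 h2]; split=> //.
- by case: (h (i + n)) h1 => // ->; rewrite eqxx.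
- exact/eqP.
- by rewrite h1; apply/negbTE.
- exact/eqP.
Qed.

Lemma lex_lt_word d (A : finOrderType d) (zero one : A) (w : nat -> A) i j n :
  (zero < one)%O -> binary zero one w ->
  lex_lt (word w i n) (word w j n) <-> below (bit one w) i j n.
Proof.
move=> lt01 h; have ne : zero != one by rewrite Order.POrderTheory.lt_eqF.
split.
  move=> [_ [l [a [c [ac /prefix_rcons_word [ln hl ha] /prefix_rcons_word [_ hl' hc]]]]]].
  exists (size l) => //; apply/(branch_bit _ _ _ h ne); split.
  - by apply/eq_word; rewrite -hl -hl'.
  - case: (h (i + size l)) => // e; case: (h (j + size l)) => e'.
      by move: ac; rewrite ha hc e e' => /(Order.POrderTheory.lt_trans lt01); rewrite Order.POrderTheory.ltxx.
    by move: ac; rewrite ha hc e e' Order.POrderTheory.ltxx.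
  - case: (h (j + size l)) => // e; case: (h (i + size l)) => e'.
      by move: ac; rewrite ha hc e e' Order.POrderTheory.ltxx.
    by move: ac; rewrite ha hc e e' => /(Order.POrderTheory.lt_trans lt01); rewrite Order.POrderTheory.ltxx.
move=> [k kn /(branch_bit _ _ _ h ne) [/eq_word e ei ej]].
split; first by rewrite !size_word.
exists (word w i k), zero, one; split=> //; apply/prefix_rcons_word; rewrite size_word //. 
Qed.

Lemma lex_consecutive_word d (A : finOrderType d) (zero one : A) (w : nat -> A) i j n :
  (zero < one)%O -> binary zero one w ->
  lex_consecutive w (word w i n) (word w j n) <-> consecutive (bit one w) i j n.
Proof.
move=> lt01 h; split.
  move=> [_ _ /(lex_lt_word _ _ _ lt01 h) hb nf]; split=> // [] [f [h1 h2]].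
  apply: nf; exists (word w f n); split; first exact: word_factor.
  - exact/(lex_lt_word _ _ _ lt01 h).
  - exact/(lex_lt_word _ _ _ lt01 h).
move=> [hb nf]; split; [exact: word_factor|exact: word_factor|exact/(lex_lt_word _ _ _ lt01 h)|].
move=> [u [[f fu] h1 h2]]; apply: nf; exists f.
have su : size u = n by case: h1 => <- _; rewrite size_word.
rewrite su -/(word w f n) in fu; rewrite fu in h1 h2.
by split; apply/(lex_lt_word _ _ _ lt01 h).
Qed.

Definition swap_words (A : eqType) (zero one : A) (v v' : seq A) : Prop :=
  exists l m : seq A,
      (v \in [:: l ++ [:: zero; one] ++ m; l ++ [:: one; zero] ++ m] /\
       v' \in [:: l ++ [:: zero; one] ++ m; l ++ [:: one; zero] ++ m]) \/
      (v \in [:: l ++ [:: zero]; l ++ [:: one]] /\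
       v' \in [:: l ++ [:: zero]; l ++ [:: one]]).

Lemma word_cat (T : eqType) (w : nat -> T) i n l u : word w i n = l ++ u ->
  [/\ n = size l + size u, l = word w i (size l) & u = word w (i + size l) (size u)].
Proof.
move=> e; have sz : n = size l + size u by rewrite -size_cat -e size_word.
move: e; rewrite {1}sz wordD => /eqP; rewrite eqseq_cat ?size_word //.
by case/andP=> /eqP -> /eqP ->.
Qed.

Lemma word_cons (T : Type) (w : nat -> T) i n : word w i n.+1 = w i :: word w i.+1 n.
Proof. by rewrite -add1n wordD /word /= addn0 addn1. Qed.

Lemma word_split (T : eqType) (zero one : T) (w : nat -> T) i j k n l x y u v :
  k < n -> agree w i j k -> w (i + k) = zero -> w (j + k) = one -> zero != one -> x != y ->
  word w i n = l ++ x :: u -> word w j n = l ++ y :: v ->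
  [/\ size l = k, x = zero, y = one, u = word w (i + k.+1) (size u) &
      v = word w (j + k.+1) (size v)].
Proof.
move=> kn ea hi hj ne xy /word_cat [ni li] /=; rewrite word_cons => [] [xi ui].
move=> /word_cat [nj lj] /=; rewrite word_cons => [] [yj vj].
have el : agree w i j (size l) by apply/eq_word; rewrite -li.
have sl : size l = k.
  have [lk|kl|//] := ltngtP (size l) k.
    by rewrite xi yj ea ?eqxx in xy.
  by have := el k kl; rewrite hi hj => e; rewrite e eqxx in ne.
by rewrite sl in xi yj ui vj; rewrite xi yj !addnS.
Qed.

(** The condition on words is symmetric and admits equal words; since the windows differ and the
    first has [zero] at the branch, one of the four combinations remains in each case. *)
Lemma swap_words_branch (T : eqType) (zero one : T) (w : nat -> T) i j k n :
  zero != one -> binary zero one w -> k < n -> branch (bit one w) i j k ->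
  swap_words zero one (word w i n) (word w j n) <->
  (k.+1 = n \/
   [/\ bit one w (i + k.+1) = true, bit one w (j + k.+1) = false &
       agree (bit one w) (i + k.+2) (j + k.+2) (n - k.+2)]).
Proof.
move=> ne h kn hk; have [ea hi hj] := (branch_bit i j k h ne).1 hk.
have ne' : one != zero by rewrite eq_sym.
have neq : word w i n <> word w j n.
  by move=> /eq_word /(_ k kn); rewrite hi hj => e; rewrite e eqxx in ne.
have split_ := word_split kn ea hi hj ne.
split.
  move=> [l [m []]]; rewrite !inE => [] [/orP[]/eqP ei /orP[]/eqP ej].
  - by case: neq; rewrite ei ej.
  - have [sl _ _ /= u v] := split_ _ _ _ _ _ ne ei ej.
    right; have : size (word w i n) = size (l ++ [:: zero, one & m]) by rewrite ei.
    rewrite size_word size_cat /= sl => en.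
    move: u v; rewrite !word_cons => [] [ui um] [vj vm].
    rewrite /bit -ui -vj eqxx; split=> //; first exact/negbTE.
    apply/(agree_bit _ _ _ h)/eq_word; rewrite !addnS in um vm *.
    have -> : n - k.+2 = size m by nat_lia.
    by rewrite -um -vm.
  - by have [_ e] := split_ _ _ _ _ _ ne' ei ej; rewrite e eqxx in ne.
  - by case: neq; rewrite ei ej.
  - by case: neq; rewrite ei ej.
  - have [sl _ _ _ _] := split_ _ _ _ _ _ ne ei ej.
    have : size (word w i n) = size (l ++ [:: zero]) by rewrite ei.
    by rewrite size_word size_cat /= sl addn1 => ->; left.
  - by have [_ e] := split_ _ _ _ _ _ ne' ei ej; rewrite e eqxx in ne.
  - by case: neq; rewrite ei ej.
move=> [kn1|[e1 e2 e3]].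
  exists (word w i k), [::]; right; rewrite !inE -kn1 !wordS hi hj -!cats1.
  by move/eq_word: ea => <-; rewrite !eqxx orbT.
(* If the windows end at the branch, the letters at [k.+1] lie outside them and the pair is x0,
   x1. *)
have [kn1|kn1] := eqVneq k.+1 n.
  exists (word w i k), [::]; right; rewrite !inE -kn1 !wordS hi hj -!cats1.
  by move/eq_word: ea => <-; rewrite !eqxx orbT.
have k2 : k.+1 < n by rewrite ltn_neqAle kn1 kn.
exists (word w i k), (word w (i + k.+2) (n - k.+2)); left; rewrite !inE.
have dec x : word w x n = word w x k ++ [:: w (x + k), w (x + k.+1) & word w (x + k.+2) (n - k.+2)].
  by rewrite [in LHS](_ : n = k + (n - k.+2).+2) ?wordD ?word_cons ?addnS //; nat_lia.
have [i1 j1] : w (i + k.+1) = one /\ w (j + k.+1) = zero.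
  split; first exact/eqP.
  by case: (h (j + k.+1)) e2 => //; rewrite /bit => ->; rewrite eqxx.
move/(agree_bit _ _ _ h)/eq_word: e3 => e3; move/eq_word: ea => ea.
by rewrite !dec hi hj i1 j1 -ea -e3 !eqxx orbT.
Qed.

Lemma swap_words_swap_rule d (A : finOrderType d) (zero one : A) (w : nat -> A) :
  (zero < one)%O -> binary zero one w ->
  swap_rule (bit one w) <->
  (forall v v', lex_consecutive w v v' -> swap_words zero one v v').
Proof.
move=> lt01 h; have ne : zero != one by rewrite Order.POrderTheory.lt_eqF.
split=> hsw.
  move=> v v' hv; have [[i vi] [j vj] [sv _] _] := hv.
  rewrite -/(word w i _) in vi; rewrite -sv -/(word w j _) in vj.
  move: (size v) vi vj => n vi vj {sv}; subst v v'.
  have /hsw [k [kn hk c]] := (lex_consecutive_word i j _ lt01 h).1 hv.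
  exact/(swap_words_branch ne h kn hk).
move=> i j n hn; have [[k kn hk] _] := hn.
exists k; split=> //; apply/(swap_words_branch ne h kn hk)/hsw.
exact/(lex_consecutive_word _ _ _ lt01 h).
Qed.

(** Applied to one-letter factors, the condition makes every occurring letter with a greater
    occurring letter equal to [zero]; a letter above [one] would thus identify [one] with [zero]. *)
Lemma swap_words_binary d (A : finOrderType d) (zero one : A) (w : nat -> A) :
  (zero < one)%O -> (exists i, w i = zero) -> (exists i, w i = one) ->
  (forall v v', lex_consecutive w v v' -> swap_words zero one v v') ->
  binary zero one w.
Proof.
move=> lt01 occ0 occ1 hsw.
have next_letter x y i j : (x < y)%O -> w i = x -> w j = y -> x = zero.
  move=> xy wi wj; pose P z := `[< exists l, w l = z >] && (x < z)%O.
  have Py : P y by rewrite /P xy andbT; apply/asboolP; exists j.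
  (* The least occurring letter above [x] is its successor. *)
  case: (Order.TotalTheory.arg_minP id Py) => z /andP[/asboolP [l wl] xz] zmin.
  have lex1 (a c : A) : lex_lt [:: a] [:: c] <-> (a < c)%O.
    split=> [[_ [u [e [f [ef]]]]]|ac].
      case: u => [|e' u] /=; last by case: u => [|? ?] /=; rewrite ?andbF.
      by rewrite !andbT => /eqP <- /eqP <-.
    by split=> //; exists [::], a, c; rewrite /= !eqxx.
  have cons : lex_consecutive w [:: x] [:: z].
    split; [by exists i; rewrite /= addn0 wi|by exists l; rewrite /= addn0 wl|exact/lex1|].
    move=> [[|f [|? ?]] [[l' fl'] h1 h2]]; [by case: h1|  |by case: h1].
    move: fl' => [] ; rewrite addn0 => fl'; move/lex1: h1 => h1; move/lex1: h2.
    rewrite Order.TotalTheory.ltNge zmin // /P h1 andbT; apply/asboolP; exists l'.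
    by [].
  have [u [v []]] := hsw _ _ cons; rewrite !inE.
    by move=> [/orP[]/eqP/(congr1 size)] /=; rewrite size_cat /=; nat_lia.
  case: u => [|? [|? ?]] /=; last 2 first.
  - by move=> [/orP[]/eqP[]].
  - by move=> [/orP[]/eqP[]].
  move=> [/orP[]/eqP[xe] /orP[]/eqP[ze]] //; move: xz; rewrite xe ze.
    by move=> /(Order.POrderTheory.lt_trans lt01); rewrite Order.POrderTheory.ltxx.
  by rewrite Order.POrderTheory.ltxx.
move=> i; case: (Order.TotalTheory.ltgtP (w i) one) => [lt1|gt1|->]; [|
  |by right].
  by left; have [j wj] := occ1; apply: (next_letter _ _ i j lt1).
have [j wj] := occ1; have e := next_letter _ _ _ _ gt1 wj (erefl (w i)).
by rewrite e Order.POrderTheory.ltxx in lt01.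
Qed.

(** * Counting factors *)

Definition words (A : finType) (w : nat -> A) (n : nat) : {set n.-tuple A} :=
  [set u : n.-tuple A | `[< factor w u >]].

Definition words_before (A : finType) (w : nat -> A) (n : nat) (a : A) : {set n.-tuple A} :=
  [set u : n.-tuple A | `[< factor w (rcons u a) >]].

Lemma mem_words (A : finType) (w : nat -> A) n (u : n.-tuple A) :
  reflect (exists i, u = word w i n :> seq A) (u \in words w n).
Proof.
rewrite inE; apply: (iffP (asboolP _)) => [[i]|[i hu]]; last by exists i; rewrite size_tuple.
by rewrite size_tuple; exists i.
Qed.

Lemma mem_words_before (A : finType) (w : nat -> A) n a (u : n.-tuple A) :
  reflect (exists2 i, u = word w i n :> seq A & w (i + n) = a) (u \in words_before w n a).
Proof.
rewrite inE; apply: (iffP (asboolP _)) => [/rcons_factor [i [] ]|[i hu ha]].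
  by rewrite size_tuple => h ha; exists i.
by apply/rcons_factor; exists i; rewrite size_tuple.
Qed.

Lemma card_words0 (A : finType) (w : nat -> A) : #|words w 0| = 1.
Proof.
apply/eqP/cards1P; exists [tuple]; apply/setP => u; rewrite [u]tuple0 in_set1 eqxx.
by apply/mem_words; exists 0.
Qed.

(** Factors of length [n.+1] are sorted by their last letter. Every factor extends to the right, so
    the union of the two sets of stems is all of [words w n], and their intersection counts the
    right special words. *)
Lemma card_wordsS (A : finType) (zero one : A) (w : nat -> A) n :
  zero != one -> binary zero one w ->
  #|words w n.+1| = #|words w n| + #|words_before w n zero :&: words_before w n one|.
Proof.
move=> ne h; set W0 := words_before w n zero; set W1 := words_before w n one.
have -> : words w n = W0 :|: W1.
  apply/setP => u; rewrite in_setU; apply/mem_words/orP => [[i hi]|].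
    by case: (h (i + n)) => e; [left | right]; apply/mem_words_before; exists i.
  by move=> [] /mem_words_before [i hi _]; exists i.
have -> : words w n.+1 = [set rcons_tuple u zero | u in W0] :|: 
                         [set rcons_tuple u one | u in W1].
  apply/setP => u; rewrite in_setU; apply/mem_words/orP => [[i hi]|].
    have sz : size (word w i n) == n by rewrite size_word.
    case: (h (i + n)) => e; [left | right]; apply/imsetP; exists (Tuple sz);
      try (by apply/mem_words_before; exists i);
      by apply: val_inj; rewrite /= hi wordS e.
  by move=> [] /imsetP [v /mem_words_before [i hi e] ->]; exists i; rewrite /= wordS hi e.
have inj a : injective (fun u : n.-tuple A => rcons_tuple u a).
  by move=> u v /(congr1 val) /= /rcons_inj [] /val_inj.
rewrite cardsU (_ : _ :&: _ = set0) ?cards0 ?subn0; last first.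
  apply/setP => u; rewrite !inE; apply/negP => /andP[/imsetP [x _ ->] /imsetP [y _]].
  by move=> /(congr1 val) /= /rcons_inj [_] /eqP; rewrite (negPf ne).
by rewrite !card_imset // -cardsUI.
Qed.

Lemma card_branching (A : finType) (zero one : A) (w : nat -> A) n :
  zero != one -> binary zero one w ->
  (#|words_before w n zero :&: words_before w n one| = 1 <->
   (exists i j, branch (bit one w) i j n) /\
   (forall i j i' j', branch (bit one w) i j n -> branch (bit one w) i' j' n ->
      agree (bit one w) i i' n)).
Proof.
move=> ne h; set S := _ :&: _.
have memS i j : branch (bit one w) i j n ->
    exists2 u : n.-tuple A, u \in S & u = word w i n :> seq A.
  move=> /(branch_bit _ _ _ h ne) [/eq_word e ei ej].
  have sz : size (word w i n) == n by rewrite size_word.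
  exists (Tuple sz) => //; rewrite in_setI; apply/andP; split.
    by apply/mem_words_before; exists i.
  by apply/mem_words_before; exists j.
have branchS (u : n.-tuple A) : u \in S ->
    exists i j, branch (bit one w) i j n /\ u = word w i n :> seq A.
  rewrite in_setI => /andP[/mem_words_before [i ui ei] /mem_words_before [j uj ej]].
  exists i, j; split=> //; apply/(branch_bit _ _ _ h ne); split=> //.
  by apply/eq_word; rewrite -ui.
split.
  move=> /eqP/cards1P [u Su]; split.
    by have [|i [j [hij _]]] := branchS u; [rewrite Su set11 | exists i, j].
  move=> i j i' j' /memS [x Sx xi] /memS [y Sy yi].
  rewrite Su !in_set1 in Sx Sy; apply/(agree_bit _ _ _ h)/eq_word.
  by rewrite -xi -yi (eqP Sx) (eqP Sy).
move=> [[i [j hij]] uniq]; have [u Su ui] := memS _ _ hij.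
apply/eqP/cards1P; exists u; apply/setP => v; rewrite in_set1.
apply/idP/eqP => [/branchS [x [y [hxy vx]]]|-> //].
apply/val_inj; rewrite /= vx ui; apply/eq_word/(agree_bit _ _ _ h).
exact: uniq hxy hij.
Qed.

(** Having n + 1 factors of each length n means that each increment, the number of right special
    words of length n, is one. *)
Lemma sturmian_branch (A : finType) (zero one : A) (w : nat -> A) :
  zero != one -> binary zero one w ->
  sturmian w <-> has_branch (bit one w) /\ unique_branch (bit one w).
Proof.
move=> ne h; split.
  move=> st; have c n := (card_branching n ne h).1.
  have c1 n : #|words_before w n zero :&: words_before w n one| = 1.
    by have := card_wordsS n ne h; rewrite /words !st; nat_lia.
  by split=> n; have [] := c n (c1 n).
move=> [hb ub] n; rewrite -/(words w n).
elim: n => [|n IH]; first exact: card_words0.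
rewrite (card_wordsS n ne h) IH (card_branching n ne h).2 ?addn1 //.
by split; [apply: hb | apply: ub].
Qed.

Lemma sturmian_few_words (A : finType) (zero one : A) (w : nat -> A) :
  binary zero one w -> sturmian w -> few_words (bit one w).
Proof.
move=> h st n f.
have sz i : size (word w i n) == n by rewrite size_word.
pose F (x : 'I_n.+2) := Tuple (sz (f x)).
have : ~~ injectiveb F.
  apply/negP => /injectiveP inj.
  have : #|F @: [set: 'I_n.+2]| <= #|words w n|.
    by apply/subset_leq_card/subsetP => u /imsetP [x _ ->]; apply/mem_words; exists (f x).
  by rewrite card_imset // cardsT card_ord /words st; nat_lia.
move=> /injectivePn [x [y xy /(congr1 val) /= /eq_word /(agree_bit _ _ _ h) e]].
have : (x != y :> nat) by [].
rewrite neq_ltn => /orP[lt|lt].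
  by exists x, y; split=> //; rewrite -ltnS.
by exists y, x; split; [|rewrite -ltnS|apply: agree_sym].
Qed.

Lemma sturmian_binary (A : finType) (zero one : A) (w : nat -> A) :
  zero != one -> (exists i, w i = zero) -> (exists i, w i = one) ->
  sturmian w -> binary zero one w.
Proof.
move=> ne [i0 e0] [i1 e1] st i.
have sub : [set [tuple zero]; [tuple one]] \subset words w 1.
  by apply/subsetP => u; rewrite in_set2 => /orP[]/eqP->; apply/mem_words;
    [exists i0 | exists i1]; rewrite /word /= addn0 ?e0 ?e1.
have eqw : [set [tuple zero]; [tuple one]] = words w 1.
  apply/eqP; rewrite eqEcard sub /words st cards2.
  by have -> : [tuple zero] != [tuple one] by apply: contraNneq ne => /(congr1 val) /= [->].
have : [tuple w i] \in words w 1.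
  by apply/mem_words; exists i; rewrite /word /= addn0.
by rewrite -eqw in_set2 => /orP[]/eqP/(congr1 val) /= [->]; [left | right].
Qed.

Theorem theorem1p1 (d : Order.disp_t) (A : finOrderType d) (zero one : A)
    (w : nat -> A) (lt01 : (zero < one)%O)
    (occ0 : exists i : nat, w i = zero) (occ1 : exists i : nat, w i = one) :
  sturmian w <->
  forall v v' : seq A, lex_consecutive w v v' ->
    exists l m : seq A,
      (v \in [:: l ++ [:: zero; one] ++ m; l ++ [:: one; zero] ++ m] /\
       v' \in [:: l ++ [:: zero; one] ++ m; l ++ [:: one; zero] ++ m]) \/
      (v \in [:: l ++ [:: zero]; l ++ [:: one]] /\
       v' \in [:: l ++ [:: zero]; l ++ [:: one]]).
Proof.
have ne : zero != one by rewrite Order.POrderTheory.lt_eqF.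
rewrite -[X in _ <-> X]/(forall v v', lex_consecutive w v v' -> swap_words zero one v v').
split=> [st|hsw].
  have h := sturmian_binary ne occ0 occ1 st.
  have [hb ub] := (sturmian_branch ne h).1 st.
  exact/(swap_words_swap_rule lt01 h)/few_words_swap_rule/(sturmian_few_words h st).
have h := swap_words_binary lt01 occ0 occ1 hsw.
have sr := (swap_words_swap_rule lt01 h).2 hsw.
have b0 : exists i, bit one w i = false.
  by have [i wi] := occ0; exists i; rewrite /bit wi; apply/negbTE.
have b1 : exists i, bit one w i = true by have [i wi] := occ1; exists i; rewrite /bit wi eqxx.
apply/(sturmian_branch ne h); split; first exact: swap_rule_has_branch.
exact: swap_rule_unique_branch.
Qed.
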